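(* Let $n\in\mathbb{N}$, $p\in(0,1)$, and let $U_N=\bigcup_{k=1}^N G_k$ be the union of $N$ independent random graphs $G_k\in\mathcal{G}(n,p)$ on the common node set $[n]$. Let $\lambda_{min}=2\left(1-\cos\frac{\pi}{n}\right)$, let $q=1-p$, and let \[ N_{min}:=\frac{1}{\log q}\log\left(\frac{4n^2+4n\cos\frac{\pi}{n}-\tau(n)-8n}{6n^2-8n}\right),\quad \tau(n):=\bigg(16n^2(n-2)\Big(1-\cos\frac{\pi}{n}\Big)+32n(2-n)\Big(1-\cos\frac{\pi}{n}\Big)^2+4n^2(n-2)^2\bigg)^{1/2}. \] Set $\hat p=1-(1-p)^N$ and $\hat q=1-\hat p$. If $N\ge N_{min}$, then \[ \mathbb{P}\big[\lambda_2(U_N)\ge\lambda_{min}\big]\ge\left(1-\frac{2\left(1-\cos\frac{\pi}{n}\right)}{n\hat p}\right)^2\left(\frac{\left(n\hat p-\sqrt{2n(n-2)\hat p\hat q}\right)^2}{n(n-2)\hat p^2+2n\hat p}\right). \]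
   Context: $\mathcal{G}(n,p)$ denotes the Erdős–Rényi model: a simple undirected graph on nodes $[n]$ in which each of the $\binom{n}{2}$ possible edges is present independently with probability $p$. The union of graphs on the same node set has as edge set the union of their edge sets. For a graph with Laplacian $L=D-A$ (degree matrix minus adjacency matrix) and eigenvalues $0=\lambda_1\le\lambda_2\le\dots\le\lambda_n$, the algebraic connectivity is $\lambda_2$; $\lambda_{min}=2(1-\cos\frac{\pi}{n})$ is the minimum algebraic connectivity among connected graphs on $n$ nodes (attained by the path graph). *)

(* Defs.v *)
From HB Require Import structures.
From mathcomp Require Import all_boot all_order all_algebra.
From mathcomp Require Import classical_sets reals exp trigo.
Set Implicit Arguments. Unset Strict Implicit. Unset Printing Implicit Defensive.
Import Order.TTheory GRing.Theory Num.Theory.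
Local Open Scope ring_scope.

Definition edge (n : nat) := {e : 'I_n * 'I_n | (e.1 < e.2)%N}.

Definition graph (n : nat) := {set edge n}.

Definition adj (n : nat) (E : graph n) (i j : 'I_n) : bool :=
  [exists e : edge n, (e \in E) && ((val e == (i, j)) || (val e == (j, i)))].

Definition adjmx (R : realType) (n : nat) (E : graph n) : 'M[R]_n :=
  \matrix_(i, j) (adj E i j)%:R.

Definition laplacian (R : realType) (n : nat) (E : graph n) : 'M[R]_n :=
  \matrix_(i, j) ((i == j)%:R * (\sum_(k < n) adjmx R E i k)) - adjmx R E.

Definition sorted_eigenvalues (R : realType) (n : nat) (M : 'M[R]_n) (s : seq R) : Prop :=
  sorted <=%R s /\ char_poly M = \prod_(x <- s) ('X - x%:P).

(* lambda_2: second smallest eigenvalue. (For a real symmetric matrix such a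
   sorted list exists and is unique.) *)
Definition lambda2 (R : realType) (n : nat) (M : 'M[R]_n) : R :=
  nth 0 (xget [::] (sorted_eigenvalues M)) 1.

Definition alg_conn (R : realType) (n : nat) (E : graph n) : R := lambda2 (laplacian R E).

Definition gnp_weight (R : realType) (n : nat) (p : R) (E : graph n) : R :=
  p ^+ #|E| * (1 - p) ^+ (#|{: edge n}| - #|E|).

Definition union_graph (n N : nat) (g : {ffun 'I_N -> graph n}) : graph n :=
  \bigcup_(k < N) g k.

Definition prob_union_conn_ge (R : realType) (n N : nat) (p c : R) : R :=
  \sum_(g : {ffun 'I_N -> graph n})
     (\prod_(k < N) gnp_weight p (g k)) * (if c <= alg_conn R (union_graph g) then 1 else 0).

Definition lambda_min (R : realType) (n : nat) : R := 2 * (1 - cos (pi / n%:R)).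

Definition tau (R : realType) (n : nat) : R :=
  let c := 1 - cos (pi / n%:R) in
  let m := n%:R in
  Num.sqrt (16 * m ^+ 2 * (m - 2) * c + 32 * m * (2 - m) * c ^+ 2
            + 4 * m ^+ 2 * (m - 2) ^+ 2).

Definition Nmin_arg (R : realType) (n : nat) : R :=
  let m := n%:R in
  (4 * m ^+ 2 + 4 * m * cos (pi / m) - tau R n - 8 * m) / (6 * m ^+ 2 - 8 * m).

Definition Nmin (R : realType) (n : nat) (p : R) : R :=
  ln (Nmin_arg R n) / ln (1 - p).

Definition phat (R : realType) (N : nat) (p : R) : R := 1 - (1 - p) ^+ N.

(* Main.v *)
(* The second moment method applied to Z = lambda_2(U_N) at threshold 0 rather
   than lambda_min: (E Z)^2 <= E[Z^2] P(Z > 0), and Z > 0 means that the graph is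
   connected, which by Fiedler's theorem is the same as Z >= lambda_min.
   Samuelson's inequality bounds E Z from below by n ph - sqrt(2n(n-2) ph qh),
   using only the first two moments of the Laplacian spectrum, and N >= N_min
   makes this bound at least lambda_min, so that the factor
   (1 - lambda_min / (n ph))^2 is at most 1.
   Fiedler's theorem: sort an eigenvector x; every cut between consecutive values
   is crossed by an edge, so the energy of x is at least that of the path, and
   the discrete Poincare inequality for the path is dual to a Dirichlet
   inequality with ground state sin(k pi / n).
   The moments come from P(U_N misses F) = (1 - p)^(N |F|) for edge sets F. *)
Require Import Defs.
From HB Require Import structures.
From mathcomp Require Import all_boot all_order all_algebra.
From mathcomp Require Import fingroup perm spectral sesquilinear complex.
From mathcomp Require Import ring lra.
From mathcomp Require Import boolp classical_sets reals exp trigo.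
Set Implicit Arguments. Unset Strict Implicit. Unset Printing Implicit Defensive.
Import Order.TTheory GRing.Theory Num.Theory.
Local Open Scope ring_scope.

(** * Spectrum of real symmetric matrices *)

Lemma char_poly_conj (F : fieldType) (n : nat) (P A : 'M[F]_n) :
  P \in unitmx -> char_poly (invmx P *m A *m P) = char_poly A.
Proof.
move=> uP; rewrite /char_poly.
have -> : char_poly_mx (invmx P *m A *m P) =
    map_mx polyC (invmx P) *m char_poly_mx A *m map_mx polyC P.
  rewrite /char_poly_mx mulmxBr mulmxBl !map_mxM; congr (_ - _).
  by rewrite scalar_mxC -mulmxA -map_mxM mulVmx // map_mx1 mulmx1.
by rewrite !det_mulmx mulrAC -det_mulmx -map_mxM mulVmx // map_mx1 det1 mul1r.
Qed.

(** Over [R[i]] the matrix is Hermitian, so the spectral theorem applies with a real diagonal. [P]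
    may stay complex, since only similarity invariants are read off later. *)
Lemma symmetric_diagonalization (R : rcfType) (n : nat) (M : 'M[R]_n) :
  M^T = M -> exists (d : 'rV[R]_n) (P : 'M[R[i]]_n), P \in unitmx /\
    map_mx (real_complex R) M =
      invmx P *m diag_mx (map_mx (real_complex R) d) *m P.
Proof.
move=> symM; set C := map_mx _ M.
have hC : C \is hermsymmx.
  apply/is_hermitianmxP; rewrite expr0 scale1r.
  apply/matrixP => i j; rewrite !mxE -[M in RHS]symM mxE.
  by apply/esym/CrealP/complex_realP; eexists.
exists (map_mx (@complex.Re R) (spectral_diag C)), (spectralmx C).
split; first exact: spectral_unit.
have /hermitian_normalmx/orthomx_spectralP/= eC := hC; rewrite {1}eC.
congr (_ *m diag_mx _ *m _); apply/rowP => i; rewrite !mxE RRe_real //.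
by have /mxOverP := hermitian_spectral_diag_real hC; apply.
Qed.

(** The principal submatrix on the nonzero entries is invertible, and passing to a submatrix cannot
    raise the rank. *)
Lemma rank_diag_mx_ge (F : fieldType) (n : nat) (d : 'rV[F]_n) :
  (#|[pred i | (d 0 i != 0)%R]| <= \rank (diag_mx d))%N.
Proof.
set A := [pred i | _]; set f : 'I_#|A| -> 'I_n := enum_val.
have uS : mxsub f f (diag_mx d) \in unitmx.
  have -> : mxsub f f (diag_mx d) = diag_mx (colsub f d).
    by apply/matrixP => i j; rewrite !mxE (inj_eq enum_val_inj).
  rewrite unitmxE unitfE det_diag; apply/prodf_neq0 => i _.
  by rewrite mxE; have := enum_valP i.
rewrite -{1}(mxrank_unit uS) -{1}[diag_mx d]mulmx1 mxsub_mul.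
rewrite (leq_trans (mxrankM_maxl _ _)) // rowsubE.
exact: mxrankM_maxr.
Qed.

Lemma symmetric_spectrum (R : rcfType) (n : nat) (M : 'M[R]_n) :
  M^T = M -> exists d : 'rV[R]_n,
    [/\ char_poly M = \prod_i ('X - (d 0 i)%:P),
        \tr M = \sum_i d 0 i,
        \tr (M *m M) = \sum_i d 0 i ^+ 2 &
        (#|[pred i | (d 0 i != 0)%R]| <= \rank M)%N].
Proof.
move=> /symmetric_diagonalization[d [P [uP eM]]]; exists d.
have inj := @complexI R.
set D := map_mx (real_complex R) d in eM.
split.
- apply: (map_poly_inj (real_complex R)).
  rewrite map_char_poly eM char_poly_conj // map_prod_XsubC.
  rewrite char_poly_trig ?diag_mx_is_trig //.
  by apply: eq_bigr => i _; rewrite !mxE eqxx.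
- apply: inj; rewrite -trace_map_mx /= eM -mulmxA mxtrace_mulC mulmxK //.
  by rewrite mxtrace_diag rmorph_sum; apply: eq_bigr => i _; rewrite mxE.
- apply: inj; rewrite -trace_map_mx /= map_mxM eM !mulmxA mulmxK //.
  rewrite mxtrace_mulC !mulmxA mulmxV // mul1mx mulmx_diag.
  rewrite mxtrace_diag rmorph_sum; apply: eq_bigr => i _.
  by rewrite !mxE rmorphXn expr2.
- rewrite -(mxrank_map (real_complex R)) eM.
  rewrite mxrankMfree ?row_free_unit // eqmxMfull ?row_full_unit ?unitmx_inv //.
  rewrite (leq_trans _ (rank_diag_mx_ge _)) // eq_leq //.
  by apply: eq_card => i; rewrite !inE mxE fmorph_eq0.
Qed.

Lemma sorted_spectrum (R : realType) (n : nat) (M : 'M[R]_n) :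
  M^T = M -> exists s : seq R,
    [/\ lambda2 M = s`_1, sorted <=%R s, size s = n,
        char_poly M = \prod_(x <- s) ('X - x%:P) &
        [/\ \tr M = \sum_(x <- s) x,
        \tr (M *m M) = \sum_(x <- s) x ^+ 2 &
        (count (predC1 0%R) s <= \rank M)%N]].
Proof.
move=> /symmetric_spectrum[d [eM trM trM2 rkM]].
pose t := [seq d 0 i | i <- index_enum 'I_n].
have et : char_poly M = \prod_(x <- t) ('X - x%:P) by rewrite big_map.
(* Exhibiting one sorted list of roots excludes the default [[::]] of [xget]; by unique
   factorization the chosen list is a permutation of [t]. *)
have sP : sorted_eigenvalues M (xget [::] (sorted_eigenvalues M)).
  apply: xgetPex; exists (sort <=%R t); split; first exact: sort_le_sorted.
  by rewrite et; apply: perm_big; rewrite perm_sym perm_sort.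
exists (xget [::] (sorted_eigenvalues M)).
case: sP; set s := xget _ _ => ss es.
have st : perm_eq s t by apply: prod_XsubC_eq; rewrite -es.
split=> //.
  by rewrite (perm_size st) size_map [index_enum _]unlock -enumT size_enum_ord.
split.
- by rewrite trM (perm_big _ st) big_map.
- by rewrite trM2 (perm_big _ st) big_map.
- rewrite (seq.permP st) count_map; apply: leq_trans rkM.
  by rewrite -sum1_card -sum1_count; apply: eq_leq; apply: eq_bigl.
Qed.

(** * The Laplacian *)

Section Laplacian.
Variables (R : realType) (n : nat).
Implicit Types (E : graph n) (i j : 'I_n).

Definition degree E i : R := \sum_j (adj E i j)%:R.

Lemma adjC E i j : adj E i j = adj E j i.
Proof. by apply: eq_existsb => e; rewrite orbC. Qed.

Lemma adjxx E i : adj E i i = false.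
Proof.
apply/negbTE/existsP => -[e /andP[_]]; rewrite orbb => /eqP ei.
by have := valP e; rewrite /= -[sval e]/(val e) ei ltnn.
Qed.

Lemma laplacianE E i j :
  laplacian R E i j = (i == j)%:R * degree E i - (adj E i j)%:R.
Proof.
by rewrite !mxE; congr (_ * _ - _); apply: eq_bigr => k _; rewrite mxE.
Qed.

Lemma laplacian_tr E : (laplacian R E)^T = laplacian R E.
Proof.
apply/matrixP => i j; rewrite mxE !laplacianE adjC eq_sym.
by case: eqP => [->|]; rewrite ?mul0r.
Qed.

Lemma laplacianC E i j : laplacian R E i j = laplacian R E j i.
Proof. by rewrite -{1}laplacian_tr mxE. Qed.

Lemma sum_diag (F : 'I_n -> 'I_n -> R) i :
  \sum_j (i == j)%:R * F i j = F i i.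
Proof.
rewrite (bigD1 i) //= eqxx mul1r big1 ?addr0 // => j ji.
by rewrite eq_sym (negbTE ji) mul0r.
Qed.

Lemma mxtrace_laplacian E : \tr (laplacian R E) = \sum_i degree E i.
Proof.
by apply: eq_bigr => i _; rewrite laplacianE eqxx adjxx mul1r subr0.
Qed.

Lemma mxtrace_laplacian_sqr E :
  \tr (laplacian R E *m laplacian R E) = \sum_i (degree E i ^+ 2 + degree E i).
Proof.
apply: eq_bigr => i _; rewrite mxE.
(* Squared entries of the Laplacian, simplified by the idempotence of the 0/1 adjacency entries. *)
rewrite (eq_bigr (fun j => (i == j)%:R * (degree E i ^+ 2 -
    2 * degree E i * (adj E i j)%:R) + (adj E i j)%:R)); last first.
  move=> j _; rewrite (laplacianC E j i) laplacianE.
  by case: eqP; case: (adj E i j) => _ /=; ring.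
rewrite big_split /=.
rewrite (sum_diag (fun i j => degree E i ^+ 2 - 2 * degree E i * (adj E i j)%:R)).
by rewrite adjxx mulr0 subr0.
Qed.

(** The factor 2 appears because the double sum meets every edge in both orders. *)
Lemma laplacian_quad E (x : 'rV[R]_n) :
  \sum_i \sum_j (adj E i j)%:R * (x 0 i - x 0 j) ^+ 2 =
  2 * \sum_j (x *m laplacian R E) 0 j * x 0 j.
Proof.
have -> : \sum_j (x *m laplacian R E) 0 j * x 0 j =
    \sum_i (degree E i * x 0 i ^+ 2 - \sum_j (adj E i j)%:R * x 0 i * x 0 j).
  rewrite (eq_bigr (fun j => \sum_i x 0 i * laplacian R E i j * x 0 j)).
    rewrite exchange_big /=; apply: eq_bigr => i _.
    rewrite -(sum_diag (fun i j => degree E i * x 0 j ^+ 2)) -sumrB.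
    apply: eq_bigr => j _; rewrite laplacianE.
    by case: eqP => [->|_] /=; ring.
  by move=> j _; rewrite mxE mulr_suml.
pose F i j : R := (adj E i j)%:R * x 0 i ^+ 2.
have sF : \sum_i \sum_j F i j = \sum_i degree E i * x 0 i ^+ 2.
  by apply: eq_bigr => i _; rewrite mulr_suml.
have sF' : \sum_i \sum_j F j i = \sum_i degree E i * x 0 i ^+ 2.
  by rewrite exchange_big.
rewrite sumrB mulrBr [2 * _]mulr_natl mulr2n -{1}sF -sF'.
rewrite -big_split mulr_sumr -sumrB; apply: eq_bigr => i _ /=.
rewrite -big_split mulr_sumr -sumrB; apply: eq_bigr => j _ /=.
by rewrite /F [adj E j i]adjC; ring.
Qed.

Lemma laplacian_eigen_quad E (x : 'rV[R]_n) a : x *m laplacian R E = a *: x ->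
  \sum_i \sum_j (adj E i j)%:R * (x 0 i - x 0 j) ^+ 2 =
  2 * a * \sum_j x 0 j ^+ 2.
Proof.
move=> xE; rewrite laplacian_quad xE -mulrA; congr (_ * _).
by rewrite mulr_sumr; apply: eq_bigr => j _; rewrite mxE -mulrA expr2.
Qed.

Lemma laplacian_row_sum E i : \sum_j laplacian R E i j = 0.
Proof.
rewrite (eq_bigr (fun j => (i == j)%:R * degree E i - (adj E i j)%:R)).
  by rewrite sumrB (sum_diag (fun i _ => degree E i)) subrr.
by move=> j _; rewrite laplacianE.
Qed.

Lemma laplacian_eigen_sum E (x : 'rV[R]_n) a :
  x *m laplacian R E = a *: x -> a * \sum_j x 0 j = 0.
Proof.
move=> xE; transitivity (\sum_j (x *m laplacian R E) 0 j).
  by rewrite xE mulr_sumr; apply: eq_bigr => j _; rewrite mxE.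
rewrite (eq_bigr (fun j => \sum_i x 0 i * laplacian R E i j)).
  rewrite exchange_big big1 // => i _ /=.
  by rewrite -mulr_sumr laplacian_row_sum mulr0.
by move=> j _; rewrite mxE.
Qed.

Lemma sqr_sum_gt0 (x : 'rV[R]_n) : x != 0 -> 0 < \sum_j x 0 j ^+ 2.
Proof.
move=> x0; rewrite lt_def sumr_ge0 ?andbT => [|j _]; last exact: sqr_ge0.
apply: contra x0; rewrite psumr_eq0 => [|j _]; last exact: sqr_ge0.
move=> /allP x0; apply/eqP/rowP => j; rewrite mxE.
by have := x0 j (mem_index_enum j); rewrite sqrf_eq0 => /eqP.
Qed.

Lemma laplacian_eigenvalue_ge0 E a : eigenvalue (laplacian R E) a -> 0 <= a.
Proof.
move=> /eigenvalueP[x xE /sqr_sum_gt0 x0].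
have : 0 <= 2 * a * \sum_j x 0 j ^+ 2.
  rewrite -(laplacian_eigen_quad xE); apply: sumr_ge0 => i _.
  by apply: sumr_ge0 => j _; rewrite mulr_ge0 ?ler0n ?sqr_ge0.
by rewrite pmulr_lge0 // pmulr_rge0.
Qed.

(* A disconnected graph has two independent indicator vectors in its kernel. *)
Lemma rank_laplacian_disconnected E (S : {set 'I_n}) a b :
  a \in S -> b \notin S ->
  (forall i j, i \in S -> j \notin S -> ~~ adj E i j) ->
  (\rank (laplacian R E) + 2 <= n)%N.
Proof.
move=> aS bS noE.
(* The rows of [A] are the indicators of [S] and of its complement; [B] selects columns [a] and [b],
   which certifies rank 2. *)
pose A : 'M[R]_(2, n) := \matrix_(k, i) ((i \in S) == (k == 0))%:R.
pose B : 'M[R]_(n, 2) := \matrix_(i, k) (i == if k == 0 then a else b)%:R.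
have AB : A *m B = 1%:M.
  apply/matrixP => k l; rewrite !mxE (bigD1 (if l == 0 then a else b)) //=.
  rewrite !mxE eqxx mulr1 big1 ?addr0 => [|i /negbTE]; last first.
    by rewrite !mxE => ->; rewrite mulr0.
  by case: k l => [[|[|//]] ?] [[|[|//]] ?] /=; rewrite ?aS ?(negbTE bS).
have rA : (2 <= \rank A)%N.
  by rewrite -{1}(mxrank1 R 2) -AB mxrankM_maxl.
have AL : A *m laplacian R E = 0.
  apply/matrixP => k j; rewrite !mxE.
  (* Adjacent nodes lie on the same side, so [A k i] may be replaced by [A k j], and the row sum
     vanishes. *)
  rewrite (eq_bigr (fun i => A k j * laplacian R E j i)) => [|i _].
    by rewrite -mulr_sumr laplacian_row_sum mulr0.
  rewrite (laplacianC E i j) [RHS]mulrC [LHS]mulrC !laplacianE !mxE.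
  case: (j =P i) => [->//|_]; rewrite mul0r sub0r !mulNr; congr (- _).
  case aij: (adj E j i); last by rewrite !mul0r.
  have -> // : (i \in S) = (j \in S).
  apply/idP/idP => [iS|jS]; apply/negPn/negP => nS.
    by have := noE _ _ iS nS; rewrite adjC aij.
  by have := noE _ _ jS nS; rewrite aij.
have := mulmx0_rank_max AL; rewrite addnC; apply: leq_trans.
by rewrite leq_add2l.
Qed.

End Laplacian.

(** * Fiedler's lower bound *)

Section PathPoincare.
Variable R : realType.
Implicit Types (x : nat -> R) (n m k : nat).

Lemma sin_node_gt0 n k : (0 < k < n)%N -> 0 < sin (k%:R * (pi / n%:R)) :> R.
Proof.
case/andP=> k0 kn; have n0 : 0 < n%:R :> R by rewrite ltr0n (ltn_trans k0).
apply: sin_gt0_pi; apply/andP; split.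
  by rewrite mulr_gt0 ?divr_gt0 ?pi_gt0 // ltr0n.
by rewrite mulrCA gtr_pMr ?pi_gt0 // ltr_pdivrMr // mul1r ltr_nat.
Qed.

(** The eigenvalue equation of the path with Dirichlet ends, for eigenvalue [lambda_min]. *)
Lemma sin_node_rec n k :
  sin (k.+2%:R * (pi / n%:R)) =
  2 * cos (pi / n%:R) * sin (k.+1%:R * (pi / n%:R))
    - sin (k%:R * (pi / n%:R)) :> R.
Proof.
set t := pi / n%:R; have -> : k.+2%:R * t = k.+1%:R * t + t :> R.
  by rewrite -[k.+2]addn1 natrD mulrDl mul1r.
have -> : k%:R * t = k.+1%:R * t - t.
  by rewrite -[k.+1]addn1 natrD mulrDl mul1r addrK.
by rewrite sinD sinB; ring.
Qed.

(* Riccati form of the ground state substitution: the ratios of the positive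
   Dirichlet eigenfunction [sin (k pi / n)] bound the partial energies. *)
Lemma dirichlet_partial n m (Y : nat -> R) : (m.+1 < n)%N -> Y 0%N = 0 ->
  Y m.+1 ^+ 2 * (1 - sin (m%:R * (pi / n%:R)) / sin (m.+1%:R * (pi / n%:R)))
    <= \sum_(k < m.+1) ((Y k.+1 - Y k) ^+ 2 - lambda_min R n * Y k ^+ 2).
Proof.
move=> mn Y0; elim: m mn => [_|m IH mn].
  by rewrite big_ord1 /= Y0 mul0r sin0 mul0r; lra.
rewrite big_ord_recr /=; have {IH} := IH (ltnW mn).
have := @sin_node_gt0 n m.+1; have := @sin_node_gt0 n m.+2.
rewrite /= mn (ltnW mn) sin_node_rec /lambda_min => /(_ isT) + /(_ isT).
set c := cos _; set u1 := sin _; set u0 := sin _; move=> u2 u1_0.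
set S := \sum_(_ < _) _; set a := Y m.+1; set b := Y m.+2 => IH.
set v := 2 * c * u1 - u0 in u2 *.
have -> : u1 / v = 1 - (1 - u1 / v) by ring.
(* By the recurrence, adding the new term to the induction hypothesis leaves a weighted AM-GM
   inequality with weight [v / u1]. *)
suff : 2 * a * b <= a ^+ 2 * (v / u1) + b ^+ 2 * (u1 / v).
  have -> : v / u1 = 2 * c - u0 / u1 by rewrite /v; field; rewrite gt_eqF.
  move: IH; nra.
rewrite -subr_ge0.
have -> : a ^+ 2 * (v / u1) + b ^+ 2 * (u1 / v) - 2 * a * b =
    (a * v - b * u1) ^+ 2 / (u1 * v).
  by field; rewrite !gt_eqF.
by rewrite mulr_ge0 ?sqr_ge0 // invr_ge0 mulr_ge0 // ltW.
Qed.

(** At the last interior node [sin pi = 0] turns the ratio into [2 * cos (pi / n)], and the partial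
    bound exactly cancels the final term. *)
Lemma dirichlet_ineq n (Y : nat -> R) : (1 < n)%N -> Y 0%N = 0 -> Y n = 0 ->
  lambda_min R n * \sum_(k < n) Y k ^+ 2 <= \sum_(k < n) (Y k.+1 - Y k) ^+ 2.
Proof.
case: n => [//|[//|m]] _ Y0 Yn.
rewrite -subr_ge0 mulr_sumr -sumrB big_ord_recr /= Yn.
have := @dirichlet_partial m.+2 m Y (ltnSn _) Y0.
have := @sin_node_gt0 m.+2 m.+1 (ltnSn _).
have := sin_node_rec m.+2 m.
rewrite [m.+2%:R * _]mulrCA divff ?pnatr_eq0 // mulr1 sinpi /lambda_min.
set u1 := sin _; set u0 := sin _; set c := cos _ => e u1_0.
have -> : u0 / u1 = 2 * c.
  have -> : u0 = 2 * c * u1 by lra.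
  by rewrite mulfK // gt_eqF.
set S := \sum_(_ < _) _; set a := Y _; nra.
Qed.

Lemma sum_by_parts m x :
  \sum_(k < m) (\sum_(j < k.+1) x j) * (x k.+1 - x k) =
  (\sum_(j < m.+1) x j) * x m - \sum_(k < m.+1) x k ^+ 2.
Proof.
elim: m => [|m IH]; first by rewrite big_ord0 !big_ord1 expr2 subrr.
by rewrite big_ord_recr /= IH !(big_ord_recr m.+1) /=; ring.
Qed.

Lemma lambda_min_ge0 n : 0 <= lambda_min R n.
Proof. by rewrite mulr_ge0 // subr_ge0 cos_le1. Qed.

(** The partial sums [Y] of [x] vanish at both ends, so [c * W <= X] by the Dirichlet inequality.
    Summation by parts gives [P = - X], and expanding the squares of gap plus [c * Y] bounds the
    energy below by [2 * c * X - c ^+ 2 * W >= c * X]. *)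
Lemma path_poincare m x : \sum_(k < m.+2) x k = 0 ->
  lambda_min R m.+2 * \sum_(k < m.+2) x k ^+ 2
    <= \sum_(k < m.+1) (x k.+1 - x k) ^+ 2.
Proof.
move=> x0; set c := lambda_min R _.
pose Y k := \sum_(j < k) x j.
have Y0 : Y 0%N = 0 by rewrite /Y big_ord0.
have := @dirichlet_ineq m.+2 Y isT Y0 x0; rewrite -/c.
have -> : \sum_(k < m.+2) (Y k.+1 - Y k) ^+ 2 = \sum_(k < m.+2) x k ^+ 2.
  by apply: eq_bigr => k _; rewrite /Y big_ord_recr /=; ring.
rewrite big_ord_recl Y0 expr0n add0r.
have := sum_by_parts m.+1 x; rewrite x0 mul0r sub0r.
set P := \sum_(_ < _) _ * _; set X := \sum_(_ < _) x _ ^+ 2.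
set W := \sum_(_ < _) _ => eP cW.
have : 0 <= \sum_(k < m.+1) (x k.+1 - x k + c * Y k.+1) ^+ 2.
  by apply: sumr_ge0 => k _; apply: sqr_ge0.
have -> : \sum_(k < m.+1) (x k.+1 - x k + c * Y k.+1) ^+ 2 =
    \sum_(k < m.+1) (x k.+1 - x k) ^+ 2 + 2 * c * P + c ^+ 2 * W.
  rewrite !mulr_sumr -!big_split /=; apply: eq_bigr => k _; rewrite /Y; ring.
have := lambda_min_ge0 m.+2; rewrite -/c eP; nra.
Qed.

(** Nonnegative gaps have nonnegative cross terms in the square of their sum. *)
Lemma sum_sqr_gaps m x i j : {in [pred k | (k < m)%N], forall k, x k <= x k.+1} ->
  (i <= j <= m)%N ->
  \sum_(k < m | (i <= k < j)%N) (x k.+1 - x k) ^+ 2 <= (x j - x i) ^+ 2.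
Proof.
move=> mono; have mono2 j' : (i <= j' <= m)%N -> x i <= x j'.
  elim: j' => [|j' IH]; first by case: i.
  rewrite leq_eqVlt => /andP[/predU1P[->//|ij] jm].
  by apply: le_trans (IH _) (mono _ jm); rewrite -ltnS ij ltnW.
elim: j => [|j IH].
  by rewrite big1 ?sqr_ge0 // => k; rewrite andbF.
case/andP; rewrite leq_eqVlt => /predU1P[->|ij] jm.
  rewrite big1 ?sqr_ge0 // => k /andP[a b]; have := leq_trans b a.
  by rewrite ltnn.
rewrite (bigD1 (Ordinal jm)) /=; last by rewrite -ltnS ij ltnS leqnn.
have ijm : (i <= j <= m)%N by rewrite -ltnS ij ltnW.
have {}IH := IH ijm.
rewrite (eq_bigl (fun k : 'I_m => (i <= k < j)%N)); last first.
  by move=> k; rewrite -val_eqE /= ltnS [in RHS]ltn_neqAle andbA andbAC.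
have := mono j jm; have := mono2 j ijm; move: IH.
by set S := \sum_(_ < _ | _) _; nra.
Qed.

(** An edge contributes at least the squared gaps it spans. After exchanging sums, each gap is
    counted at least twice, once for each order of a crossing edge. *)
Lemma monotone_energy_ge m (e : rel 'I_m.+2) x :
  {in [pred k | (k < m.+1)%N], forall k, x k <= x k.+1} -> symmetric e ->
  (forall k : 'I_m.+1, exists i j, [/\ e i j, (i <= k)%N & (k < j)%N]) ->
  2 * \sum_(k < m.+1) (x k.+1 - x k) ^+ 2 <=
    \sum_i \sum_j (e i j)%:R * (x i - x j) ^+ 2.
Proof.
move=> mono sym_e cut.
pose C (i j : 'I_m.+2) (k : 'I_m.+1) := ((i <= k < j) || (j <= k < i))%N.
have gap i j : \sum_(k < m.+1 | C i j k) (x k.+1 - x k) ^+ 2 <= (x i - x j) ^+ 2.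
  wlog ij : i j / (i <= j)%N => [H|].
    case/orP: (leq_total i j) => [/H //|/H];
      rewrite -[leRHS]sqrrN opprB; apply: le_trans.
    by rewrite [leRHS](eq_bigl (C i j)) // => k; rewrite /C orbC.
  rewrite -sqrrN opprB; have := @sum_sqr_gaps m.+1 x i j mono.
  rewrite ij -ltnS ltn_ord => /(_ isT); apply: le_trans.
  rewrite (eq_bigl (fun k : 'I_m.+1 => (i <= k < j)%N)) // => k.
  rewrite /C; apply/orb_idr => /andP[jk ki].
  by have := leq_trans (leq_ltn_trans jk ki) ij; rewrite ltnn.
apply: (@le_trans _ _ (\sum_i \sum_j \sum_(k < m.+1)
    (e i j && C i j k)%:R * (x k.+1 - x k) ^+ 2)); last first.
  apply: ler_sum => i _; apply: ler_sum => j _.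
  case: (e i j); last by rewrite big1 ?mul0r // => k _; rewrite mul0r.
  rewrite mul1r; apply: le_trans (gap i j); rewrite [leRHS]big_mkcond.
  by apply: ler_sum => k _ /=; case: (C i j k); rewrite ?mul1r ?mul0r.
under [leRHS]eq_bigr do rewrite exchange_big.
rewrite [leRHS]exchange_big mulr_sumr; apply: ler_sum => k _ /=.
have [i0 [j0 [eij ik kj]]] := cut k.
set g := _ ^+ 2; have g0 : 0 <= g by apply: sqr_ge0.
pose F i j : R := (e i j && C i j k)%:R * g.

have F0 i j : 0 <= F i j by rewrite mulr_ge0.
have row_ge i j : F i j <= \sum_j F i j.
  by rewrite (bigD1 j) //= lerDl sumr_ge0.
have ji : j0 != i0 by rewrite -val_eqE gtn_eqF // (leq_ltn_trans ik).
have Fij : F i0 j0 = g by rewrite /F eij /C ik kj mul1r.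
have Fji : F j0 i0 = g by rewrite /F sym_e eij /C ik kj orbT mul1r.
(* The distinct rows [i0] and [j0] each contribute one copy of [g]. *)
apply: (@le_trans _ _ (\sum_j F i0 j + \sum_j F j0 j)).
  rewrite mulr_natl mulr2n.
  by apply: lerD; [rewrite -[leLHS]Fij | rewrite -[leLHS]Fji]; apply: row_ge.
rewrite [leRHS](bigD1 i0) //= lerD2l [leRHS](bigD1 j0) //= lerDl.
by apply: sumr_ge0 => i _; apply: sumr_ge0 => j _; apply: F0.
Qed.

End PathPoincare.

Lemma monotone_reindex (R : realType) n (x : 'I_n -> R) :
  exists p : 'S_n, forall i j : 'I_n, (i <= j)%N -> x (p i) <= x (p j).
Proof.
pose t := [tuple x i | i < n].
have /tuple_permP[p ep] : perm_eq (sort <=%R t) t by rewrite perm_sort.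
exists p => i j ij.
have nthE (k : 'I_n) : nth 0 (sort <=%R t) k = x (p k).
  by rewrite ep -tnth_nth !tnth_mktuple.
rewrite -!nthE; apply: sorted_leq_nth => //.
- exact: le_trans.
- exact: sort_le_sorted.
- by rewrite inE size_sort size_tuple.
- by rewrite inE size_sort size_tuple.
Qed.

(** Connectivity is phrased through cuts, the form supplied by the rank argument and consumed by the
    energy comparison. *)
Definition connected_graph n (E : graph n) :=
  forall (S : {set 'I_n}) a b, a \in S -> b \notin S ->
    exists i j, [/\ i \in S, j \notin S & adj E i j].

Lemma fiedler_bound (R : realType) n (E : graph n) (x : 'I_n -> R) :
  (1 < n)%N -> connected_graph E -> \sum_i x i = 0 ->
  2 * (lambda_min R n * \sum_i x i ^+ 2) <=
    \sum_i \sum_j (adj E i j)%:R * (x i - x j) ^+ 2.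
Proof.
case: n E x => [//|[//|m]] E x _ conn x0.
have [p mono] := monotone_reindex x.
pose y k := x (p (inord k)).
have yE (i : 'I_m.+2) : y i = x (p i) by rewrite /y inord_val.
have sy (f : R -> R) : \sum_i f (x i) = \sum_(k < m.+2) f (y k).
  by rewrite (reindex_inj (@perm_inj _ p)); apply: eq_bigr => i _; rewrite yE.
have y0 : \sum_(k < m.+2) y k = 0 by rewrite -(sy id).
rewrite (sy (fun z => z ^+ 2)).
apply: (@le_trans _ _ (2 * \sum_(k < m.+1) (y k.+1 - y k) ^+ 2)).
  by rewrite ler_pM2l // path_poincare.
rewrite (reindex_inj (@perm_inj _ p)) /=.
under [leRHS]eq_bigr do rewrite (reindex_inj (@perm_inj _ p)) /=.
under [leRHS]eq_bigr do under eq_bigr do rewrite -!yE.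
apply: (monotone_energy_ge (e := fun i j => adj E (p i) (p j))).
- move=> k; rewrite inE => km; rewrite /y; apply: mono.
  by rewrite !inordK // ltnW.
- by move=> i j; rewrite adjC.
(* The nodes carrying the [k.+1] first values in sorted order form a cut; its crossing edge spans
   gap [k]. *)
- move=> k; pose S := [set p i | i : 'I_m.+2 & (i <= k)%N].
  have inS i : (p i \in S) = (i <= k)%N.
    by rewrite mem_imset ?inE //; exact: perm_inj.
  have [||i [j [iS jS ij]]] := conn S (p ord0) (p ord_max).
  + by rewrite inS.
  + by rewrite inS -ltnNge.
  exists ((p^-1)%g i), ((p^-1)%g j).
  rewrite !permKV; split=> //; first by rewrite -inS permKV.
  by rewrite ltnNge -inS permKV.
Qed.

(** * Algebraic connectivity against the first two spectral moments *)

Lemma sqr_sum_le (R : realFieldType) (t : seq R) :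
  (\sum_(x <- t) x) ^+ 2 <= (size t)%:R * \sum_(x <- t) x ^+ 2.
Proof.
elim: t => [|x t IH]; first by rewrite !big_nil mul0r expr0n.
rewrite !big_cons /= mulrS.
have : 0 <= \sum_(y <- t) (x - y) ^+ 2 by apply: sumr_ge0 => y _; apply: sqr_ge0.
have -> : \sum_(y <- t) (x - y) ^+ 2 = (size t)%:R * x ^+ 2
    - 2 * x * \sum_(y <- t) y + \sum_(y <- t) y ^+ 2.
  elim: t {IH} => [|y t IH]; first by rewrite !big_nil /=; ring.
  by rewrite !big_cons IH /= [(size t).+1%:R]mulrS; ring.
move: IH; set A := \sum_(_ <- _) _; set B := \sum_(_ <- _) _; nra.
Qed.

Section AlgebraicConnectivity.
Variables (R : realType) (n : nat).
Implicit Type E : graph n.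

Lemma laplacian_eigenvalue0 E : (0 < n)%N -> eigenvalue (laplacian R E) 0.
Proof.
move=> n0; apply/eigenvalueP; exists (const_mx 1).
  apply/rowP => j; rewrite scale0r mxE [RHS]mxE -[RHS](laplacian_row_sum R E j).
  by apply: eq_bigr => i _; rewrite [const_mx _ _ _]mxE mul1r laplacianC.
by apply/eqP => /rowP/(_ (Ordinal n0))/eqP; rewrite !mxE oner_eq0.
Qed.

Lemma connected_of_rank E : (n < \rank (laplacian R E) + 2)%N -> connected_graph E.
Proof.
move=> rkE S a b aS bS; apply: contrapT => noE; move: rkE; apply/negP.
rewrite -leqNgt; apply: (rank_laplacian_disconnected R aS bS) => i j iS jS.
by apply/negP => aij; apply: noE; exists i, j.
Qed.

(** The spectrum is [0], [z] and a list [t] of [n - 2] values above [z]. The last clause is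
    Samuelson's inequality, which reduces to Cauchy-Schwarz on [t]. *)
Lemma alg_conn_spec E : (1 < n)%N ->
  let z := alg_conn R E in
  let T := \sum_i degree R E i in
  let Q := \sum_i (degree R E i ^+ 2 + degree R E i) in
  [/\ 0 <= z, z != 0 -> lambda_min R n <= z,
      (n%:R - 1) * z ^+ 2 <= Q &
      (T - (n%:R - 1) * z) ^+ 2 <= (n%:R - 2) * ((n%:R - 1) * Q - T ^+ 2)].
Proof.
move=> n1 z T Q; rewrite /z {z} /alg_conn.
have [s [-> ss sn es [trT trQ rkE]]] := sorted_spectrum (laplacian_tr R E).
rewrite mxtrace_laplacian -/T in trT.
rewrite mxtrace_laplacian_sqr -/Q in trQ.
have eig a : (a \in s) = eigenvalue (laplacian R E) a.
  by rewrite eigenvalue_root_char es root_prod_XsubC.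
case: s sn => [|a [|z t]] sn in ss es trT trQ rkE eig *; do ?by rewrite -sn in n1.
have nE : n%:R = (size t)%:R + 2 :> R by rewrite -sn /= -addn2 natrD.
have ge0 b : b \in [:: a, z & t] -> 0 <= b.
  by rewrite eig; apply: laplacian_eigenvalue_ge0.
move: (ss); rewrite /= => /andP[az pt].
have zt b : b \in t -> z <= b by apply: (allP (order_path_min le_trans pt)).
have a0 : a = 0.
  apply/eqP; rewrite eq_le ge0 ?mem_head // andbT.
  have : 0 \in [:: a, z & t] by rewrite eig laplacian_eigenvalue0 // ltnW.
  rewrite !inE => /or3P[/eqP<-//|/eqP->//|/zt]; exact: le_trans.
have z0 : 0 <= z by rewrite ge0 // !inE eqxx orbT.
rewrite a0 !big_cons in trT trQ; rewrite /= trT trQ nE; split=> //.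
(* If [z] is nonzero, the rank is at least [n - 1], so the graph is connected; an eigenvector for
   [z] sums to 0, so Fiedler's bound applies. *)
- move=> z_neq0; have z_gt0 : 0 < z by rewrite lt_def z_neq0.
  have cE : connected_graph E.
    apply: connected_of_rank; rewrite addn2 -[ltnLHS]sn !ltnS; apply: leq_trans rkE.
    rewrite /= a0 eqxx z_neq0 add0n add1n ltnS.
    have /eqP -> // : count (predC1 0%R) t == size t.
    rewrite -all_count; apply/allP => b /zt zb /=.
    by rewrite gt_eqF // (lt_le_trans z_gt0).
  have : z \in [:: a, z & t] by rewrite !inE eqxx orbT.
  rewrite eig => /eigenvalueP[x xE x_neq0].
  have x0 : \sum_j x 0 j = 0.
    by apply/eqP; have /eqP := laplacian_eigen_sum xE; rewrite mulf_eq0 (negbTE z_neq0).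
  have := fiedler_bound n1 cE x0; rewrite (laplacian_eigen_quad xE) -mulrA.
  by rewrite ler_pM2l // ler_pM2r // sqr_sum_gt0.
- rewrite expr0n add0r; have -> : (size t)%:R + 2 - 1 = (size t)%:R + 1 :> R by ring.
  rewrite mulrDl mul1r addrC lerD2l.
  have : \sum_(b <- t) z ^+ 2 <= \sum_(b <- t) b ^+ 2.
    rewrite !big_seq; apply: ler_sum => b bt; rewrite ler_sqr ?nnegrE ?zt //.
    by rewrite ge0 // !inE bt !orbT.
  by rewrite big_const_seq count_predT iter_addr_0 mulr_natl.
- rewrite expr0n !add0r; have := sqr_sum_le t.
  set A := \sum_(_ <- _) _; set B := \sum_(_ <- _) _.
  have : 0 <= (size t)%:R :> R by [].
  nra.
Qed.

End AlgebraicConnectivity.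

(** * Moments of the union graph *)

Section UnionExpectation.
Variables (R : realType) (n N : nat) (p : R).
Implicit Types (F G : graph n) (f h : graph n -> R) (i j k : 'I_n).

Definition union_expect f : R :=
  \sum_(g : {ffun 'I_N -> graph n})
     (\prod_(k < N) gnp_weight p (g k)) * f (union_graph g).

Lemma union_expectD f h :
  union_expect (fun G => f G + h G) = union_expect f + union_expect h.
Proof. by rewrite -big_split; apply: eq_bigr => g _; rewrite mulrDr. Qed.

Lemma union_expectZ (a : R) f :
  union_expect (fun G => a * f G) = a * union_expect f.
Proof. by rewrite mulr_sumr; apply: eq_bigr => g _; rewrite mulrCA. Qed.

Lemma union_expect_sum (I : finType) (P : pred I) (f : I -> graph n -> R) :
  union_expect (fun G => \sum_(i | P i) f i G) = \sum_(i | P i) union_expect (f i).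
Proof.
by rewrite exchange_big; apply: eq_bigr => g _ /=; rewrite mulr_sumr.
Qed.

Lemma eq_union_expect f h : f =1 h -> union_expect f = union_expect h.
Proof. by move=> fh; apply: eq_bigr => g _; rewrite fh. Qed.

Lemma gnp_weight_prod G :
  gnp_weight p G = \prod_(e : edge n) (if e \in G then p else 1 - p).
Proof.
rewrite (bigID (mem G)) /=; congr (_ * _).
  by rewrite (eq_bigr (fun=> p)) ?prodr_const // => e ->.
rewrite (eq_bigr (fun=> 1 - p)) => [|e /negbTE-> //].
rewrite prodr_const -(cardC (mem G)) addKn.
by congr (_ ^+ _); apply: eq_card => e; rewrite !inE.
Qed.

Lemma gnp_avoid F :
  \sum_G gnp_weight p G * [disjoint F & G]%:R = (1 - p) ^+ #|F|.
Proof.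
(* Presence weight 0 on [F] encodes avoidance; the sum over graphs then factors over edges, with
   factor [1 - p] on [F] and 1 elsewhere. *)
pose a e := if e \in F then 0 else p.
transitivity (\sum_(G : graph n) \prod_e (if e \in G then a e else 1 - p)).
  apply: eq_bigr => G _; rewrite gnp_weight_prod.
  have [/pred0P FG | /pred0Pn[e /andP[/= eF eG]]] := boolP [disjoint F & G].
    rewrite mulr1; apply: eq_bigr => e _; have := FG e; rewrite /= /a.
    by case: (e \in G); case: (e \in F).
  by rewrite mulr0 (bigD1 e) //= eG /a eF mul0r.
rewrite -bigA_distr (bigID (mem F)) /= [X in _ * X]big1 ?mulr1 => [|e /negbTE eF].
  by rewrite (eq_bigr (fun=> 1 - p)) ?prodr_const // => e eF; rewrite /a eF add0r.
by rewrite /a eF addrC subrK.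
Qed.

(** The union misses [F] exactly when every [g k] does, so the expectation factors over [k]. *)
Lemma union_expect_avoid F :
  union_expect (fun G => [disjoint F & G]%:R) = ((1 - p) ^+ N) ^+ #|F|.
Proof.
transitivity (\prod_(k < N) \sum_G gnp_weight p G * [disjoint F & G]%:R).
  rewrite bigA_distr_bigA; apply: eq_bigr => g _; rewrite [RHS]big_split /=.
  congr (_ * _); rewrite -natr_prod; congr _%:R.
  case: bigcup_disjointP => [dF|nF].
    by rewrite big1 // => k _; rewrite dF.
  have /existsP[k /negbTE nFk] : [exists k, ~~ [disjoint F & g k]].
    by rewrite -negb_forall; apply/negP => /forallP dF; apply: nF => k _; apply: dF.
  by rewrite (bigD1 k) //= nFk.
by rewrite prodr_const card_ord gnp_avoid exprAC.
Qed.

Hypothesis p01 : 0 < p < 1.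

Lemma union_weight_ge0 (g : {ffun 'I_N -> graph n}) :
  0 <= \prod_(k < N) gnp_weight p (g k).
Proof.
case/andP: p01 => p0 p1; apply: prodr_ge0 => k _.
by apply: mulr_ge0; apply: exprn_ge0; rewrite ?subr_ge0 ltW.
Qed.

Lemma union_expect_ge0 f : (forall G, 0 <= f G) -> 0 <= union_expect f.
Proof.
by move=> f0; apply: sumr_ge0 => g _; rewrite mulr_ge0 ?union_weight_ge0.
Qed.

Lemma union_expect1 : union_expect (fun=> 1) = 1.
Proof.
rewrite -[RHS](expr0 ((1 - p) ^+ N)) -[in RHS](cards0 (edge n)) -union_expect_avoid.
by apply: eq_union_expect => G; rewrite -finset.setI_eq0 finset.set0I eqxx.
Qed.

Lemma ler_union_expect f h : (forall G, f G <= h G) ->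
  union_expect f <= union_expect h.
Proof.
by move=> fh; apply: ler_sum => g _; rewrite ler_wpM2l ?union_weight_ge0.
Qed.

Lemma union_cauchy_schwarz f h :
  union_expect (fun G => f G * h G) ^+ 2 <=
    union_expect (fun G => f G ^+ 2) * union_expect (fun G => h G ^+ 2).
Proof.
set a := union_expect _; set b := union_expect _; set c := union_expect _.
have quad t : 0 <= t ^+ 2 * b - 2 * t * a + c.
  have -> : t ^+ 2 * b - 2 * t * a + c =
      union_expect (fun G => (t * f G - h G) ^+ 2).
    rewrite -mulNr -!union_expectZ -!union_expectD.
    by apply: eq_union_expect => G; ring.
  by apply: union_expect_ge0 => G; apply: sqr_ge0.
have b0 : 0 <= b by apply: union_expect_ge0 => G; apply: sqr_ge0.
have [b_eq0|b_neq0] := eqVneq b 0.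
  have [-> |a_neq0] := eqVneq a 0; first by rewrite expr0n b_eq0 mul0r.
  (* With [b = 0] the quadratic is affine in [t], and this [t] gives it the value -1. *)
  have := quad ((c + 1) / (2 * a)); rewrite b_eq0.
  have -> : 2 * ((c + 1) / (2 * a)) * a = c + 1 by field.
  by rewrite mulr0; lra.
(* The minimizer of the quadratic. *)
have := quad (a / b).
have -> : (a / b) ^+ 2 * b - 2 * (a / b) * a + c = (b * c - a ^+ 2) / b by field.
by rewrite pmulr_lge0 ?subr_ge0 // invr_gt0 lt_def b_neq0.
Qed.

Lemma union_expect0 f : (forall G, f G = 0) -> union_expect f = 0.
Proof. by move=> f0; apply: big1 => g _; rewrite f0 mulr0. Qed.

Lemma adj_edge i j : i != j -> exists e : edge n,
  (val e == (i, j)) || (val e == (j, i)) /\ forall G, adj G i j = (e \in G).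
Proof.
wlog ij : i j / (i < j)%N => [H ij|_].
  have [/H|ji|/val_inj /eqP] := ltngtP i j; [exact | | by rewrite (negbTE ij)].
  rewrite eq_sym in ij; have [e [ve eG]] := H j i ji ij.
  by exists e; split=> [|G]; [rewrite orbC | rewrite adjC eG].
exists (exist _ (i, j) ij); split; first by rewrite /= eqxx.
move=> G; apply/existsP/idP => [[e /andP[eG /orP[]/eqP ve]]|eG].
- by rewrite (_ : exist _ _ _ = e) //; apply: val_inj.
- by have := valP e; rewrite /= -/(val e) ve /= ltnNge ltnW.
- by exists (exist _ (i, j) ij); rewrite eG eqxx.
Qed.

Lemma adj_avoid i j : i != j -> exists e : edge n,
  (val e == (i, j)) || (val e == (j, i)) /\
  forall G, (adj G i j)%:R = 1 - [disjoint [set e] & G]%:R :> R.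
Proof.
move=> /adj_edge[e [ve eG]]; exists e; split=> // G.
by rewrite eG finset.disjoints1; case: (e \in G); rewrite ?subr0 ?subrr.
Qed.

Let ph := phat N p.

Lemma union_expect_adj i j :
  union_expect (fun G => (adj G i j)%:R) = ph - (i == j)%:R * ph.
Proof.
have [-> |ij] := eqVneq i j.
  by rewrite mul1r subrr union_expect0 // => G; rewrite adjxx.
have [e [_ eG]] := adj_avoid ij.
rewrite (eq_union_expect eG) union_expectD union_expect1 mul0r subr0.
rewrite (eq_union_expect (h := fun G => -1 * [disjoint [set e] & G]%:R)) => [|G].
  by rewrite union_expectZ union_expect_avoid cards1 expr1 mulN1r.
by rewrite mulN1r.
Qed.

Lemma union_expect_adj2 i j k : i != j ->
  union_expect (fun G => (adj G i j)%:R * (adj G i k)%:R) =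
    ph ^+ 2 + (j == k)%:R * (ph - ph ^+ 2) - (i == k)%:R * ph ^+ 2.
Proof.
move=> ij; have [<-|ik] := eqVneq i k.
  rewrite [j == i]eq_sym (negbTE ij) mul0r addr0 mul1r subrr.
  by rewrite union_expect0 // => G; rewrite adjxx mulr0.
have [<-|jk] := eqVneq j k.
  rewrite mul1r mul0r subr0 addrC subrK.
  rewrite -[RHS]subr0 -(mul0r ph) -[0 in RHS]/(false%:R) -(negbTE ij).
  rewrite -union_expect_adj; apply: eq_union_expect => G.
  by case: adj; rewrite ?mulr1 ?mulr0.
have [e [ve eG]] := adj_avoid ij; have [e' [ve' eG']] := adj_avoid ik.
have ee' : e != e'.
  apply: contraNneq jk => ee'; move: ve ve'; rewrite ee' => /orP[]/eqP-> /orP[].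
  - by rewrite xpair_eqE eqxx.
  - by rewrite xpair_eqE (negbTE ik).
  - by rewrite xpair_eqE [j == i]eq_sym (negbTE ij).
  - by rewrite xpair_eqE => /andP[].
(* Inclusion-exclusion for the presence of two distinct edges, in terms of avoidance events. *)
rewrite (eq_union_expect (h := fun G => 1 + (-1 * [disjoint [set e] & G]%:R +
    (-1 * [disjoint [set e'] & G]%:R + [disjoint [set e; e'] & G]%:R)))).
  rewrite !union_expectD !union_expectZ union_expect1 !union_expect_avoid.
  by rewrite !cards1 cards2 ee' /ph /phat /=; ring.
move=> G; rewrite eG eG'.
rewrite (_ : [disjoint [set e; e'] & G] =
   [disjoint [set e] & G] && [disjoint [set e'] & G]) -?mulnb ?natrM; last first.
  by rewrite -!finset.setI_eq0 finset.setIUl finset.setU_eq0.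
ring.
Qed.

Lemma union_expect_degree i :
  union_expect (fun G => degree R G i) = (n%:R - 1) * ph.
Proof.
rewrite union_expect_sum; under eq_bigr do rewrite union_expect_adj.
rewrite sumrB (sum_diag (fun _ _ => ph)) sumr_const card_ord mulrBl mul1r.
by rewrite mulr_natl.
Qed.

Lemma union_expect_degree2 i :
  union_expect (fun G => degree R G i ^+ 2) =
    (n%:R - 1) * (ph + (n%:R - 2) * ph ^+ 2).
Proof.
rewrite (eq_union_expect (h := fun G => \sum_j \sum_k
    (adj G i j)%:R * (adj G i k)%:R)) => [|G]; last first.
  by rewrite expr2 mulr_suml; apply: eq_bigr => j _; rewrite mulr_sumr.
(* The sum over [k] for a fixed [j != i]: one term with [k = j], and [n - 2] pairs of distinct
   edges. *)
pose v := ph + (n%:R - 2) * ph ^+ 2.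
rewrite union_expect_sum (eq_bigr (fun j => v - (i == j)%:R * v)) => [|j _].
  rewrite sumrB (sum_diag (fun _ _ => v)) sumr_const card_ord mulrBl mul1r.
  by rewrite mulr_natl.
have [<-|ij] := eqVneq i j.
  rewrite mul1r subrr union_expect0 // => G; rewrite big1 // => k _.
  by rewrite adjxx mul0r.
rewrite union_expect_sum; under eq_bigr do rewrite union_expect_adj2 //.
rewrite sumrB big_split /= sumr_const card_ord.
rewrite (sum_diag (fun _ _ => ph - ph ^+ 2)) (sum_diag (fun _ _ => ph ^+ 2)).
by rewrite -mulr_natl /v; ring.
Qed.

End UnionExpectation.

(** * Moment bounds for the algebraic connectivity of the union *)

Section FirstAndSecondMoments.
Variables (R : realType) (n N : nat) (p : R).
Hypotheses (n1 : (1 < n)%N) (p01 : 0 < p < 1).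
Let ph : R := phat N p.
Let m : R := n%:R.
Let Z (G : graph n) := alg_conn R G.
Let T (G : graph n) := \sum_i degree R G i.
Let Q (G : graph n) := \sum_i (degree R G i ^+ 2 + degree R G i).
Let EU : (graph n -> R) -> R := union_expect N p.

Let m_ge2 : 2 <= m.
Proof. by rewrite /m ler_nat. Qed.

Lemma union_expect_trace : EU T = m * (m - 1) * ph.
Proof.
rewrite /EU union_expect_sum; under eq_bigr do rewrite union_expect_degree //.
by rewrite sumr_const card_ord -[LHS]mulr_natl mulrA.
Qed.

(** The second factor is the denominator of the final bound; [m - 1] cancels against
    [(n - 1) * z ^+ 2 <= Q]. *)
Lemma union_expect_trace_sqr :
  EU Q = (m - 1) * (m * (m - 2) * ph ^+ 2 + 2 * m * ph).
Proof.
rewrite /EU union_expect_sum.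
under eq_bigr do rewrite union_expectD union_expect_degree // union_expect_degree2 //.
by rewrite sumr_const card_ord -[LHS]mulr_natl -/m -/ph; ring.
Qed.

Lemma union_expect_sqr_le (f : graph n -> R) : EU f ^+ 2 <= EU (fun G => f G ^+ 2).
Proof.
have := union_cauchy_schwarz N p01 f (fun=> 1).
rewrite (eq_union_expect _ _ (h := f)) => [|G]; last by rewrite mulr1.
rewrite (eq_union_expect _ _ (f := fun=> 1 ^+ 2) (h := fun=> 1)) => [|G];
  last exact: expr1n.
by rewrite union_expect1 // mulr1.
Qed.

(* Samuelson's inequality bounds the gap between the mean nonzero Laplacian
   eigenvalue and the smallest one by their standard deviation. *)
Lemma union_expect_alg_conn_ge :
  m * ph - Num.sqrt (2 * m * (m - 2) * ph * (1 - ph)) <= EU Z.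
Proof.
have m_gt0 : 0 < m - 1 by have := m_ge2; lra.
pose W G := T G + (1 - m) * Z G.
have EW : EU W = EU T + (1 - m) * EU Z by rewrite -union_expectZ -union_expectD.
have EW2 : EU W ^+ 2 <= (m - 1) ^+ 2 * (2 * m * (m - 2) * ph * (1 - ph)).
  apply: le_trans (union_expect_sqr_le W) _.
  apply: (@le_trans _ _ (EU (fun G => (m - 2) * ((m - 1) * Q G + -1 * T G ^+ 2)))).
    apply: ler_union_expect => // G; have [_ _ _] := alg_conn_spec R G n1.
    by rewrite mulN1r -/(Z G) -/(T G) -/(Q G) /W -/m -[1 - m]opprB mulNr.
  rewrite /EU !(union_expectZ, union_expectD) -/EU union_expect_trace_sqr.
  (* Jensen's inequality discards the variance of the trace. *)
  have := union_expect_sqr_le T; rewrite union_expect_trace => ET2.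
  rewrite -subr_ge0.
  have -> : (m - 1) ^+ 2 * (2 * m * (m - 2) * ph * (1 - ph)) -
    (m - 2) * ((m - 1) * ((m - 1) * (m * (m - 2) * ph ^+ 2 + 2 * m * ph)) +
      -1 * EU (fun G => T G ^+ 2)) =
    (m - 2) * (EU (fun G => T G ^+ 2) - (m * (m - 1) * ph) ^+ 2) by ring.
  by rewrite mulr_ge0 ?subr_ge0.
have : EU W <= (m - 1) * Num.sqrt (2 * m * (m - 2) * ph * (1 - ph)).
  apply: le_trans (ler_norm _) _.
  rewrite -[X in X * _](gtr0_norm m_gt0) -!sqrtr_sqr -sqrtrM ?sqr_ge0 //.
  exact: ler_wsqrtr.
rewrite EW union_expect_trace => EWS; rewrite -(ler_pM2l m_gt0).
by move: (Num.sqrt _) (EU Z) EWS => S z; lra.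
Qed.

Lemma paley_zygmund_alg_conn :
  EU Z ^+ 2 <= (m * (m - 2) * ph ^+ 2 + 2 * m * ph) *
    prob_union_conn_ge n N p (lambda_min R n).
Proof.
pose I (G : graph n) : R := if lambda_min R n <= Z G then 1 else 0.
have -> : prob_union_conn_ge n N p (lambda_min R n) = EU (fun G => I G ^+ 2).
  apply: eq_bigr => g _; congr (_ * _).
  by rewrite /I /Z; case: ifP; rewrite ?expr1n ?expr0n.
(* [Z] is either 0 or at least [lambda_min], so multiplying by the indicator changes nothing. *)
have -> : EU Z = EU (fun G => Z G * I G).
  apply: eq_union_expect => G; have [_ cZ _ _] := alg_conn_spec R G n1.
  have [->|/cZ] := eqVneq (Z G) 0; first by rewrite mul0r.
  by rewrite /I -/(Z G) => ->; rewrite mulr1.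
apply: le_trans (union_cauchy_schwarz N p01 Z I) _.
apply: ler_wpM2r; first by apply: union_expect_ge0 => // G; apply: sqr_ge0.
have m_gt0 : 0 < m - 1 by have := m_ge2; lra.
rewrite -(ler_pM2l m_gt0) -union_expect_trace_sqr -union_expectZ.
by apply: ler_union_expect => // G; have [_ _] := alg_conn_spec R G n1.
Qed.

(** * The threshold on the edge probability of the union *)

Lemma phat_itv : 0 <= ph <= 1.
Proof.
case/andP: p01 => p0 p1; rewrite /ph /phat subr_ge0 gerBl.
by rewrite exprn_ile1 ?exprn_ge0 // ?subr_ge0 ?gerBl ltW.
Qed.

(** Since [ln (1 - p) < 0], clearing the denominator reverses the inequality and yields
    [(1 - p) ^+ N <= Nmin_arg R n]. *)
Lemma phat_ge_of_Nmin : 0 < Nmin_arg R n -> Nmin n p <= N%:R ->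
  1 - Nmin_arg R n <= ph.
Proof.
case/andP: p01 => p0 p1 arg0; have q0 : 0 < 1 - p by rewrite subr_gt0.
have lnq : ln (1 - p) < 0 by apply: ln_lt0; rewrite q0 gtrBl.
rewrite /Nmin ler_ndivrMr // mulr_natl -lnXn // ler_ln ?posrE ?exprn_gt0 //.
by rewrite /ph /phat lerD2l lerN2.
Qed.

Lemma lambda_min_le2 : lambda_min R n <= 2.
Proof.
rewrite ger_pMr // gerBl; apply: cos_ge0_pihalf.
have pi0 := pi_ge0 R; have n0 : 0 < n%:R :> R by rewrite ltr0n ltnW.
apply/andP; split; first by rewrite (@le_trans _ _ 0) ?oppr_le0 ?divr_ge0 // ltW.
by rewrite ler_wpM2l // lef_pV2 ?posrE // ler_nat.
Qed.

(* [1 - Nmin_arg R n] is the larger root of the quadratic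
   [(m x - lambda_min)^2 = 2 m (m - 2) x (1 - x)]. *)
Lemma phat_threshold : 1 - Nmin_arg R n <= ph ->
  Num.sqrt (2 * m * (m - 2) * ph * (1 - ph)) <= m * ph - lambda_min R n.
Proof.
have c2 := lambda_min_le2; have c0 := lambda_min_ge0 R n; move: c2 c0.
rewrite /Nmin_arg /tau -/m; set c := lambda_min R n => c2 c0.
have -> : cos (pi / m) = 1 - c / 2 by rewrite /c /lambda_min -/m; field.
set r := 16 * _ * _ * _ + _ + _.
(* The quadratic is [D / 2 * x ^+ 2 - K * x + c ^+ 2], with discriminant [r] and larger root
   [(K + Num.sqrt r) / D]. *)
set D := 6 * _ - _; pose K := 2 * m * c + 2 * m * (m - 2).
have m2 := m_ge2.
have D0 : 0 < D by rewrite /D; nra.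
have rE : r = K ^+ 2 - 2 * D * c ^+ 2 by rewrite /r /K /D; field.
have t0 : 0 <= Num.sqrt r by exact: sqrtr_ge0.
(* As [Num.sqrt] is 0 on negatives, this inequality holds for either sign of [r]. *)
have t2 : r <= Num.sqrt r ^+ 2.
  by have [/sqr_sqrtr -> //|/ltW r0] := leP 0 r; apply: le_trans r0 (sqr_ge0 _).
move: (Num.sqrt r) t0 t2 => t t0 t2 H.
have Kt : K + t <= D * ph.
  have -> : K + t = D * (1 - (4 * m ^+ 2 + 4 * m * (1 - c / 2) - t - 8 * m) / D).
    by rewrite /K /D; field; rewrite -/D gt_eqF.
  by rewrite ler_pM2l.
have quad : 2 * m * (m - 2) * ph * (1 - ph) <= (m * ph - c) ^+ 2.
  have : r <= (D * ph - K) ^+ 2.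
    by apply: le_trans t2 _; rewrite ler_sqr ?nnegrE //; lra.
  rewrite -subr_ge0 rE => h; rewrite -subr_ge0 -(pmulr_rge0 _ D0).
  rewrite -(pmulr_rge0 _ (ltr0Sn R 1)); congr (0 <= _): h.
  by rewrite /K /D; ring.
(* The sign is needed to take square roots in [quad]. If it failed, [m * t < D * c - m * K] would
   follow; squaring contradicts [c <= 2 <= m]. *)
have cph : c <= m * ph.
  rewrite leNgt; apply/negP => phc.
  have m0 : 0 <= m by lra.
  have tlt : m * t < D * c - m * K.
    have := ler_wpM2l m0 Kt.
    have : D * (m * ph) < D * c by rewrite ltr_pM2l.
    lra.
  have mt0 : 0 <= m * t by exact: mulr_ge0.
  have : (m * t) ^+ 2 < (D * c - m * K) ^+ 2.
    by rewrite ltr_sqr ?nnegrE //; apply: ltW; apply: le_lt_trans tlt.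
  have : m ^+ 2 * r <= (m * t) ^+ 2 by rewrite exprMn ler_wpM2l ?sqr_ge0.
  move=> /le_lt_trans H' /H'; rewrite -subr_gt0 rE.
  have -> : (D * c - m * K) ^+ 2 - m ^+ 2 * (K ^+ 2 - 2 * D * c ^+ 2) =
      D * (4 * m * (m - 2) * c) * (c - m) by rewrite /K /D; ring.
  apply/negP; rewrite -leNgt; apply: mulr_ge0_le0; last by lra.
  apply: mulr_ge0; first exact: ltW.
  by apply: mulr_ge0 => //; apply: mulr_ge0; [exact: mulr_ge0 | rewrite subr_ge0].
rewrite -(ler_sqr) ?nnegrE ?sqrtr_ge0 ?subr_ge0 //.
have [/sqr_sqrtr->//|/ltW/ler0_sqrtr->] := leP 0 (2 * m * (m - 2) * ph * (1 - ph)).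
by rewrite expr0n sqr_ge0.
Qed.

End FirstAndSecondMoments.

Theorem theorem3 (R : realType) (n N : nat) (p : R) :
  (2 <= n)%N -> 0 < p < 1 ->
  0 < Nmin_arg R n ->
  Nmin n p <= N%:R ->
  let ph := phat N p in
  let qh := 1 - ph in
  let m := n%:R in
  prob_union_conn_ge n N p (lambda_min R n) >=
    (1 - 2 * (1 - cos (pi / m)) / (m * ph)) ^+ 2 *
    ((m * ph - Num.sqrt (2 * m * (m - 2) * ph * qh)) ^+ 2 /
     (m * (m - 2) * ph ^+ 2 + 2 * m * ph)).
Proof.
move=> n2 p01 arg0 hN; lazy zeta.
set ph := phat N p; set qh := 1 - ph; set m := n%:R.
have := phat_threshold n2 (phat_ge_of_Nmin p01 arg0 hN).
have := union_expect_alg_conn_ge N n2 p01.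
have := paley_zygmund_alg_conn N n2 p01.
rewrite -/ph -/qh -/m -[2 * (1 - cos _)]/(lambda_min R n).
have c0 := lambda_min_ge0 R n.
have m2 : 2 <= m by rewrite ler_nat.
have /andP[ph0 _] : 0 <= ph <= 1 := phat_itv N p01.
set c := lambda_min R n in c0 *; set P := prob_union_conn_ge _ _ _ _.
set S := Num.sqrt _; set B := _ + 2 * m * ph; set z := union_expect _ _ _.
move=> zBP az Sc.
have S0 : 0 <= S by apply: sqrtr_ge0.
have mph0 : 0 <= m * ph by rewrite mulr_ge0.
have B0 : 0 <= B.
  apply: addr_ge0; last by rewrite -mulrA mulr_ge0.
  by apply: mulr_ge0 (sqr_ge0 _); rewrite mulr_ge0 ?subr_ge0.
(* [Sc] and [c0] make [m * ph - S] nonnegative, so its bound by [z] can be squared. *)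
have a2 : (m * ph - S) ^+ 2 <= B * P.
  by apply: le_trans zBP; rewrite ler_sqr ?nnegrE; lra.
have P0 : 0 <= P.
  apply: sumr_ge0 => g _; rewrite mulr_ge0 ?(union_weight_ge0 p01) //.
  by case: ifP.
apply: (@le_trans _ _ ((m * ph - S) ^+ 2 / B)); last first.
  (* If [B = 0] the quotient is 0 by convention, and [P0] suffices. *)
  have [->|B_neq0] := eqVneq B 0; first by rewrite invr0 mulr0.
  by rewrite ler_pdivrMr ?lt_def ?B_neq0 // [leRHS]mulrC.
apply: ler_piMl; first by rewrite divr_ge0 ?sqr_ge0.
have r0 : 0 <= c / (m * ph) by rewrite divr_ge0.
have r1 : c / (m * ph) <= 1.
  have [->|mph_neq0] := eqVneq (m * ph) 0; first by rewrite invr0 mulr0.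
  by rewrite ler_pdivrMr ?lt_def ?mph_neq0 // mul1r; lra.
rewrite -[leRHS](expr1n _ 2) ler_sqr ?nnegrE //; lra.
Qed.
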